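(* Consider the 1-D semi-discrete flux globalization based well-balanced path-conservative central-upwind (WB PCCU) scheme $$\frac{{\rm d}}{{\rm d}t}\overline{\boldsymbol W}_k=-\frac{\boldsymbol{\mathcal H}_{k+\frac12}-\boldsymbol{\mathcal H}_{k-\frac12}}{\Delta y},\qquad k=1,\dots,N,$$ described in the context, with Coriolis parameter $f(y)=f_c+\beta y$. The scheme is well-balanced in the sense that it exactly preserves the family of steady states $$hv\equiv{\rm Const},\quad E\equiv{\rm Const},\quad hb\equiv{\rm Const},\quad B\equiv0,$$ $$u(y)=\frac{(hv)^2}{(hv)^2-(hb)^2}\Big(f_cy+\frac{\beta}{2}y^2\Big)+u_c,\qquad a(y)=\frac{(hv)(hb)}{(hv)^2-(hb)^2}\Big(f_cy+\frac{\beta}{2}y^2\Big)+a_c,$$ where $u_c,a_c$ are constants. Precisely: let $(hv)_{\rm eq},E_{\rm eq},(hb)_{\rm eq},u_c,a_c\in\mathbb R$ with $(hv)_{\rm eq}^2\neq(hb)_{\rm eq}^2$, and let $u(\cdot),a(\cdot)$ be the functions given by the formulas above with $hv=(hv)_{\rm eq}$, $hb=(hb)_{\rm eq}$. If, at some time $t$, the discrete data satisfy, for every $k$ (including ghost cells), $$(\overline{hv})_k=(hv)_{\rm eq},\quad E_k=E_{\rm eq},\quad(\overline{hb})_k=(hb)_{\rm eq},\quad\overline B_k=0,\quad u_k=u(y_k),\quad a_k=a(y_k),$$ then $\boldsymbol{\mathcal H}_{k+\frac12}=\boldsymbol{\mathcal H}_{k-\frac12}$, that is, $\frac{{\rm d}}{{\rm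 d}t}\overline{\boldsymbol W}_k=\boldsymbol 0$, for all $k=1,\dots,N$.
   Context: **Variables.** $g>0$ is constant, $Z=Z(y)$ is a given bottom topography, and $f(y)=f_c+\beta y$ with constants $f_c,\beta$. The unknowns are $\boldsymbol U=(h,hu,hv,ha,hb)^\top$ with $h>0$, together with $B$ (standing for $(hb)_y$), and $\boldsymbol W=(\boldsymbol U^\top,B)^\top$. For given $\boldsymbol U$, set $u=hu/h$, $v=hv/h$, $a=ha/h$, $b=hb/h$. The continuous equilibrium variable is $E=\frac{v^2}{2}+g(h+Z)-\frac{b^2}{2}+\int_{y_{1/2}}^y f(\eta)u(\eta,t)\,{\rm d}\eta$. Put $$\boldsymbol F(\boldsymbol U)=\begin{pmatrix} hv \\ huv-hab \\ hv^2+\frac g2h^2-hb^2 \\ hav-hbu \\ 0 \end{pmatrix},\qquad M(\boldsymbol U)=\begin{pmatrix} 1&0&0&0&0 \\ u&hv&0&-hb&0 \\ v&0&h&0&0 \\ a&-hb&0&hv&0 \\ 0&0&0&0&v \end{pmatrix},\qquad \mathbf e_2=(0,1,0,0,0)^\top .$$ **Grid.** Uniform cells $C_k=[y_{k-\frac12},y_{k+\frac12}]$ of size $\Delta y$ with centers $y_k$, $k=1,\dots,N$. As many ghost cells on each side as the stencils below require are used, with cell values $\overline h_k>0$, $(\overline{hv})_k,u_k,E_k,a_k,(\overline{hb})_k,\overline B_k$ prescribed by the boundary conditions. Write $f_k=f(y_k)$, $Z_k=Z(y_k)$. **Cell values.** For $k=1,\dots,N$: $u_k=(\overline{hu})_k/\overline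 h_k$, $a_k=(\overline{ha})_k/\overline h_k$, $$E_k=\frac{(\overline{hv})_k^2}{2\overline h_k^2}+g(\overline h_k+Z_k)-\frac{(\overline{hb})_k^2}{2\overline h_k^2}+P_k,$$ where $P_1=\frac{\Delta y}4(f_{\frac12}u_{\frac12}+f_1u_1)$, $P_k=P_{k-1}+\frac{\Delta y}2(f_{k-1}u_{k-1}+f_ku_k)$ for $k\ge2$; $f_{\frac12}=f(y_{\frac12})$ and $u_{\frac12}$ is given by the boundary conditions. **Generalized minmod reconstruction** (parameter $\Theta\in[1,2]$). For values $\psi_k$, the slope is $(\psi_y)_k={\rm minmod}\big(\Theta\frac{\psi_{k+1}-\psi_k}{\Delta y},\frac{\psi_{k+1}-\psi_{k-1}}{2\Delta y},\Theta\frac{\psi_k-\psi_{k-1}}{\Delta y}\big)$, where minmod is the minimum of its arguments if all are positive, the maximum if all are negative, and $0$ otherwise. The interface values are $\psi^-_{k+\frac12}=\psi_k+\frac{\Delta y}2(\psi_y)_k$ and $\psi^+_{k+\frac12}=\psi_{k+1}-\frac{\Delta y}2(\psi_y)_{k+1}$. **WENO-Z interpolation.** $\psi^-_{k+\frac12}=\sum_{\ell=0}^2\omega_{k,\ell}\mathcal P_{k,\ell}(y_{k+\frac12})$, where $\mathcal P_{k,0},\mathcal P_{k,1},\mathcal P_{k,2}$ are the quadratic polynomials interpolating $\psi$ at $(y_{k-2},y_{k-1},y_k)$, $(y_{k-1},y_k,y_{k+1})$, $(y_k,y_{k+1},y_{k+2})$, respectively. Here $\omega_{k,\ell}=\alpha_{k,\ell}/(\alpha_{k,0}+\alpha_{k,1}+\alpha_{k,2})$,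 $\alpha_{k,\ell}=d_\ell\big[1+\big(\tau_{k,5}/(\beta_{k,\ell}+\varepsilon)\big)^r\big]$, $d_0=\frac1{16}$, $d_1=\frac58$, $d_2=\frac5{16}$, $r=2$, $\varepsilon=10^{-12}$, $\tau_{k,5}=|\beta_{k,2}-\beta_{k,0}|$, and $\beta_{k,0}=\frac{13}{12}(\psi_{k-2}-2\psi_{k-1}+\psi_k)^2+\frac14(\psi_{k-2}-4\psi_{k-1}+3\psi_k)^2$, $\beta_{k,1}=\frac{13}{12}(\psi_{k-1}-2\psi_k+\psi_{k+1})^2+\frac14(\psi_{k-1}-\psi_{k+1})^2$, $\beta_{k,2}=\frac{13}{12}(\psi_k-2\psi_{k+1}+\psi_{k+2})^2+\frac14(3\psi_k-4\psi_{k+1}+\psi_{k+2})^2$. The value $\psi^+_{k+\frac12}$ is obtained mirror-symmetrically. **Interface values.** $hv,E,B,Z$ are reconstructed from $(\overline{hv})_k,E_k,\overline B_k,Z_k$ by generalized minmod. $hb$ is reconstructed by the same linear formula but with slope $\overline B_k$. $u$ and $a$ are reconstructed from $u_k,a_k$ by generalized minmod if $\beta=0$ and by WENO-Z if $\beta\neq0$. This gives $\boldsymbol E^\pm_{k+\frac12}=\big((hv)^\pm,u^\pm,E^\pm,a^\pm,(hb)^\pm\big)^\top_{k+\frac12}$, $B^\pm_{k+\frac12}$, $Z^\pm_{k+\frac12}$. With $w_k=\overline h_k+Z_k$ reconstructed by generalized minmod, set $\breve h^\pm_{k+\frac12}=w^\pm_{k+\frac12}-Z^\pm_{k+\frac12}$.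 Let $P_{\frac12}=0$ and $P_{k+\frac12}=P_{k-\frac12}+\Delta y\,f_ku_k$. Then $h^\pm_{k+\frac12}$ is the positive root closest to $\breve h^\pm_{k+\frac12}$ of $$\frac{\big((hv)^\pm_{k+\frac12}\big)^2-\big((hb)^\pm_{k+\frac12}\big)^2}{2(h^\pm_{k+\frac12})^2}+g\big(h^\pm_{k+\frac12}+Z^\pm_{k+\frac12}\big)+P_{k+\frac12}=E^\pm_{k+\frac12},$$ and $h^\pm_{k+\frac12}=\breve h^\pm_{k+\frac12}$ if there is no positive root. All computed values $h^\pm_{k+\frac12}$ are assumed positive. Then $(hu)^\pm=h^\pm u^\pm$, $(ha)^\pm=h^\pm a^\pm$, $\boldsymbol U^\pm_{k+\frac12}=(h^\pm,(hu)^\pm,(hv)^\pm,(ha)^\pm,(hb)^\pm)^\top_{k+\frac12}$, and $\boldsymbol W^\pm_{k+\frac12}=(\boldsymbol U^\pm_{k+\frac12},B^\pm_{k+\frac12})$. **Modified values.** $\widehat{\boldsymbol W}^\pm_{k+\frac12}=(\widehat h^\pm,\widehat h^\pm u^\pm,(hv)^\pm,\widehat h^\pm a^\pm,(hb)^\pm,B^\pm)^\top_{k+\frac12}$, where $\widehat h^\pm_{k+\frac12}$ is obtained in the same manner as $h^\pm_{k+\frac12}$ from the same equation with $Z^\pm_{k+\frac12}$ replaced by $Z_{k+\frac12}=\frac12(Z^-_{k+\frac12}+Z^+_{k+\frac12})$. Standing property of this construction: whenever $(hv)^-_{k+\frac12}=(hv)^+_{k+\frac12}$, $(hb)^-_{k+\frac12}=(hb)^+_{k+\frac12}$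 and $E^-_{k+\frac12}=E^+_{k+\frac12}$ (so that the two modified equations coincide), the same value is taken on both sides, $\widehat h^-_{k+\frac12}=\widehat h^+_{k+\frac12}$. **Global fluxes.** $\boldsymbol K(\boldsymbol U^\pm_{k+\frac12})=\boldsymbol F(\boldsymbol U^\pm_{k+\frac12})-\boldsymbol R^\pm_{k+\frac12}$, with $\boldsymbol R^-_{\frac12}=\boldsymbol0$, $\boldsymbol R^+_{\frac12}=\boldsymbol Q_{\boldsymbol\Psi,\frac12}$, $\boldsymbol R^-_{k+\frac12}=\boldsymbol R^+_{k-\frac12}+\boldsymbol Q_k$, $\boldsymbol R^+_{k+\frac12}=\boldsymbol R^-_{k+\frac12}+\boldsymbol Q_{\boldsymbol\Psi,k+\frac12}$ for $k=1,\dots,N$, where $$\boldsymbol Q_k=\boldsymbol F(\boldsymbol U^-_{k+\frac12})-\boldsymbol F(\boldsymbol U^+_{k-\frac12})-\tfrac12\big[M(\boldsymbol U^-_{k+\frac12})+M(\boldsymbol U^+_{k-\frac12})\big]\big(\boldsymbol E^-_{k+\frac12}-\boldsymbol E^+_{k-\frac12}\big)+\Delta y\,f_k(\overline{hv})_k\,\mathbf e_2,$$ $$\boldsymbol Q_{\boldsymbol\Psi,k+\frac12}=\boldsymbol F(\boldsymbol U^+_{k+\frac12})-\boldsymbol F(\boldsymbol U^-_{k+\frac12})-\tfrac12\big[M(\boldsymbol U^+_{k+\frac12})+M(\boldsymbol U^-_{k+\frac12})\big]\big(\boldsymbol E^+_{k+\frac12}-\boldsymbol E^-_{k+\frac12}\big).$$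 **Numerical fluxes.** With $\boldsymbol H(\boldsymbol W^\pm_{k+\frac12})=\big(\boldsymbol K(\boldsymbol U^\pm_{k+\frac12}),\,v^\pm_{k+\frac12}B^\pm_{k+\frac12}\big)$, $$\boldsymbol{\mathcal H}_{k+\frac12}=\frac{s^+\boldsymbol H(\boldsymbol W^-_{k+\frac12})-s^-\boldsymbol H(\boldsymbol W^+_{k+\frac12})}{s^+-s^-}+\frac{s^+s^-}{s^+-s^-}\big(\widehat{\boldsymbol W}^+_{k+\frac12}-\widehat{\boldsymbol W}^-_{k+\frac12}\big),$$ where $s^\pm=s^\pm_{k+\frac12}$ are $s^+=\max\{v^-+\sqrt{(b^-)^2+gh^-},\,v^++\sqrt{(b^+)^2+gh^+},\,0\}$ and $s^-=\min\{v^--\sqrt{(b^-)^2+gh^-},\,v^+-\sqrt{(b^+)^2+gh^+},\,0\}$, evaluated at $k+\frac12$ with $v^\pm=(hv)^\pm/h^\pm$, $b^\pm=(hb)^\pm/h^\pm$. *)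

(* Defs.v *)
From HB Require Import structures.
From mathcomp Require Export all_boot all_order all_algebra.
From mathcomp Require Export all_classical all_reals all_analysis.
Export Order.TTheory GRing.Theory Num.Theory.
Export numFieldNormedType.Exports.

Set Implicit Arguments.
Unset Strict Implicit.
Unset Printing Implicit Defensive.

Local Open Scope ring_scope.

(* Cells are indexed by [int] (cell 1 is the leftmost physical cell, ghost cells
   have index < 1 or > ncell); the interface k+1/2 is indexed by k : nat. *)

Record setup (R : realType) := Setup {
  grav : R;
  fc : R;
  beta : R;
  bottom : R -> R;
  theta : R;
  yleft : R; (* y_{1/2} *)
  dy : R;
  ncell : nat }.

Record ghost_data (R : realType) := GhostData {
  ghost_h : int -> R;
  ghost_hv : int -> R;
  ghost_u : int -> R;
  ghost_E : int -> R;
  ghost_a : int -> R;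
  ghost_hb : int -> R;
  ghost_B : int -> R;
  uhalf : R (* u_{1/2} *) }.

(* [Minus] is the left trace ("-"), [Plus] the right trace ("+"). *)
Inductive side := Minus | Plus.

Section Generic.
Context {R : realType}.

Definition colv (n : nat) (s : seq R) : 'cV[R]_n := \col_(i < n) s`_i.

Definition entry (n : nat) (w : 'cV[R]_n.+1) (i : nat) : R := w (inord i) 0.

Definition minmod (x y z : R) : R :=
  if [&& 0 < x, 0 < y & 0 < z] then Num.min x (Num.min y z)
  else if [&& x < 0, y < 0 & z < 0] then Num.max x (Num.max y z)
  else 0.

(* Value at x of the polynomial of degree <= 2 through (x_i, p_i), i = 0, 1, 2,
   in Lagrange form. *)
Definition interp2 (x0 x1 x2 p0 p1 p2 x : R) : R :=
  p0 * ((x - x1) * (x - x2)) / ((x0 - x1) * (x0 - x2)) +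
  p1 * ((x - x0) * (x - x2)) / ((x1 - x0) * (x1 - x2)) +
  p2 * ((x - x0) * (x - x1)) / ((x2 - x0) * (x2 - x1)).

(* h is a positive root of S closest to ref, or ref if S has no positive root.
   This is a relation because two roots can be equally close to ref. *)
Definition closest_positive_root (S : R -> Prop) (ref h : R) : Prop :=
  [/\ 0 < h, S h & forall x, 0 < x -> S x -> `|h - ref| <= `|x - ref|] \/
  ((forall x, 0 < x -> ~ S x) /\ h = ref).

(* U = (h, hu, hv, ha, hb) *)
Definition Fflux (g : R) (U : 'cV[R]_5) : 'cV[R]_5 :=
  let h := entry U 0 in let hu := entry U 1 in let hv := entry U 2 in
  let ha := entry U 3 in let hb := entry U 4 in
  let u := hu / h in let v := hv / h in let a := ha / h in let b := hb / h in
  colv 5 [:: hv;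
             h * u * v - h * a * b;
             h * v ^+ 2 + g / 2%:R * h ^+ 2 - h * b ^+ 2;
             h * a * v - h * b * u;
             0].

Definition Mmat (U : 'cV[R]_5) : 'M[R]_5 :=
  let h := entry U 0 in let hu := entry U 1 in let hv := entry U 2 in
  let ha := entry U 3 in let hb := entry U 4 in
  let u := hu / h in let v := hv / h in let a := ha / h in
  \matrix_(i < 5, j < 5)
    (nth [::] [:: [:: 1; 0; 0; 0; 0];
                  [:: u; hv; 0; - hb; 0];
                  [:: v; 0; h; 0; 0];
                  [:: a; - hb; 0; hv; 0];
                  [:: 0; 0; 0; 0; v]] i)`_j.

End Generic.

Section Scheme.
Context {R : realType} (p : setup R).

Definition fcor (y : R) : R := fc p + beta p * y.

Definition ycell (k : int) : R := yleft p + (k%:~R - 1 / 2%:R) * dy p.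
Definition yface (n : nat) : R := yleft p + n%:R * dy p.
Definition fcell (k : int) : R := fcor (ycell k).
Definition Zcell (k : int) : R := bottom p (ycell k).

Definition physical (k : int) : bool := 1 <= k <= (ncell p)%:Z.

(* WENO-Z reaches three cells beyond the boundary, minmod two. *)
Definition nghost : int := if beta p == 0 then 2 else 3.

(* All cells, ghost cells included. *)
Definition in_grid (k : int) : bool := 1 - nghost <= k <= (ncell p)%:Z + nghost.

(* Linear reconstruction with slopes sl, at interface n + 1/2. *)
Definition linrec (psi sl : int -> R) (s : side) (n : nat) : R :=
  match s with
  | Minus => psi n%:Z + dy p / 2%:R * sl n%:Z
  | Plus => psi (n.+1)%:Z - dy p / 2%:R * sl (n.+1)%:Z
  end.

Definition mmslope (psi : int -> R) (k : int) : R :=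
  minmod (theta p * ((psi (k + 1) - psi k) / dy p))
         ((psi (k + 1) - psi (k - 1)) / (2%:R * dy p))
         (theta p * ((psi k - psi (k - 1)) / dy p)).

Definition mmrec (psi : int -> R) : side -> nat -> R := linrec psi (mmslope psi).

Definition weno_eps : R := (10%:R ^+ 12)^-1.

(* One-sided WENO-Z value at x from the stencil centred at cell k.  For d = 1 it
   is the formula for psi^-; for d = -1 the stencil is read in the opposite
   direction, which is the mirror image used for psi^+. *)
Definition wenoz_at (psi : int -> R) (d k : int) (x : R) : R :=
  let q (j : int) := psi (k + d * j) in
  let y (j : int) := ycell (k + d * j) in
  let P0 := interp2 (y (-2)) (y (-1)) (y 0) (q (-2)) (q (-1)) (q 0) x in
  let P1 := interp2 (y (-1)) (y 0) (y 1) (q (-1)) (q 0) (q 1) x in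
  let P2 := interp2 (y 0) (y 1) (y 2) (q 0) (q 1) (q 2) x in
  let b0 := 13%:R / 12%:R * (q (-2) - 2%:R * q (-1) + q 0) ^+ 2
            + 1 / 4%:R * (q (-2) - 4%:R * q (-1) + 3%:R * q 0) ^+ 2 in
  let b1 := 13%:R / 12%:R * (q (-1) - 2%:R * q 0 + q 1) ^+ 2
            + 1 / 4%:R * (q (-1) - q 1) ^+ 2 in
  let b2 := 13%:R / 12%:R * (q 0 - 2%:R * q 1 + q 2) ^+ 2
            + 1 / 4%:R * (3%:R * q 0 - 4%:R * q 1 + q 2) ^+ 2 in
  let tau := `|b2 - b0| in
  let alpha (w b : R) := w * (1 + (tau / (b + weno_eps)) ^+ 2) in
  let a0 := alpha (1 / 16%:R) b0 in
  let a1 := alpha (5%:R / 8%:R) b1 in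
  let a2 := alpha (5%:R / 16%:R) b2 in
  let A := a0 + a1 + a2 in
  a0 / A * P0 + a1 / A * P1 + a2 / A * P2.

Definition wenorec (psi : int -> R) (s : side) (n : nat) : R :=
  match s with
  | Minus => wenoz_at psi 1 n%:Z (yface n)
  | Plus => wenoz_at psi (-1) (n.+1)%:Z (yface n)
  end.

Definition uarec (psi : int -> R) : side -> nat -> R :=
  if beta p == 0 then mmrec psi else wenorec psi.

Section Data.
(* W k = (h, hu, hv, ha, hb, B) is only used for physical k; all other cell
   values come from G. *)
Context (W : int -> 'cV[R]_6) (G : ghost_data R).

Definition fill (inner ghost : int -> R) (k : int) : R :=
  if physical k then inner k else ghost k.

Definition cell_h : int -> R := fill (fun k => entry (W k) 0) (ghost_h G).
Definition cell_hv : int -> R := fill (fun k => entry (W k) 2) (ghost_hv G).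
Definition cell_hb : int -> R := fill (fun k => entry (W k) 4) (ghost_hb G).
Definition cell_B : int -> R := fill (fun k => entry (W k) 5) (ghost_B G).
Definition cell_u : int -> R :=
  fill (fun k => entry (W k) 1 / entry (W k) 0) (ghost_u G).
Definition cell_a : int -> R :=
  fill (fun k => entry (W k) 3 / entry (W k) 0) (ghost_a G).

(* P_k for k >= 1; the value at 0 is never used. *)
Fixpoint Pcell (k : nat) : R :=
  match k with
  | 0%N => 0
  | m.+1 =>
    if m == 0%N
    then dy p / 4%:R * (fcor (yface 0) * uhalf G + fcell 1 * cell_u 1)
    else Pcell m + dy p / 2%:R * (fcell m%:Z * cell_u m%:Z
                                  + fcell (m.+1)%:Z * cell_u (m.+1)%:Z)
  end.

Definition cell_E : int -> R :=
  fill (fun k => cell_hv k ^+ 2 / (2%:R * cell_h k ^+ 2)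
                 + grav p * (cell_h k + Zcell k)
                 - cell_hb k ^+ 2 / (2%:R * cell_h k ^+ 2)
                 + Pcell (absz k)) (ghost_E G).

Definition cell_w (k : int) : R := cell_h k + Zcell k.

Definition face_hv : side -> nat -> R := mmrec cell_hv.
Definition face_E : side -> nat -> R := mmrec cell_E.
Definition face_B : side -> nat -> R := mmrec cell_B.
Definition face_Z : side -> nat -> R := mmrec Zcell.
Definition face_hb : side -> nat -> R := linrec cell_hb cell_B.
Definition face_u : side -> nat -> R := uarec cell_u.
Definition face_a : side -> nat -> R := uarec cell_a.
Definition breve_h (s : side) (n : nat) : R := mmrec cell_w s n - face_Z s n.

Definition Evec (s : side) (n : nat) : 'cV[R]_5 :=
  colv 5 [:: face_hv s n; face_u s n; face_E s n; face_a s n; face_hb s n].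

(* P_{n+1/2} *)
Fixpoint Pface (n : nat) : R :=
  match n with
  | 0%N => 0
  | m.+1 => Pface m + dy p * fcell (m.+1)%:Z * cell_u (m.+1)%:Z
  end.

Definition height_eq (Zv : R) (s : side) (n : nat) (h : R) : Prop :=
  (face_hv s n ^+ 2 - face_hb s n ^+ 2) / (2%:R * h ^+ 2)
  + grav p * (h + Zv) + Pface n = face_E s n.

Definition is_face_height (h : side -> nat -> R) (n : nat) : Prop :=
  forall s, closest_positive_root (height_eq (face_Z s n) s n) (breve_h s n) (h s n).

Definition Zmid (n : nat) : R := (face_Z Minus n + face_Z Plus n) / 2%:R.

Definition is_mod_height_at (s : side) (n : nat) (h : R) : Prop :=
  closest_positive_root (height_eq (Zmid n) s n) (breve_h s n) h.

Definition same_mod_eq (n : nat) : Prop :=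
  [/\ face_hv Minus n = face_hv Plus n,
      face_hb Minus n = face_hb Plus n &
      face_E Minus n = face_E Plus n].

(* When the two modified equations coincide, the roots closest to breve_h Minus
   and to breve_h Plus may differ; the construction then takes one of them on
   both sides. *)
Definition is_mod_height (hh : side -> nat -> R) (n : nat) : Prop :=
  (~ same_mod_eq n -> forall s, is_mod_height_at s n (hh s n)) /\
  (same_mod_eq n -> hh Minus n = hh Plus n /\
                    exists s, is_mod_height_at s n (hh s n)).

Section Flux.
Context (h hh : side -> nat -> R).

Definition face_U (s : side) (n : nat) : 'cV[R]_5 :=
  colv 5 [:: h s n; h s n * face_u s n; face_hv s n;
             h s n * face_a s n; face_hb s n].

Definition face_What (s : side) (n : nat) : 'cV[R]_6 :=
  colv 6 [:: hh s n; hh s n * face_u s n; face_hv s n;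
             hh s n * face_a s n; face_hb s n; face_B s n].

Definition e2 : 'cV[R]_5 := colv 5 [:: 0; 1; 0; 0; 0].

(* Q_k, for the cell k = m + 1 *)
Definition Qcell (m : nat) : 'cV[R]_5 :=
  let Um := face_U Minus m.+1 in
  let Up := face_U Plus m in
  Fflux (grav p) Um - Fflux (grav p) Up
  - 2%:R^-1 *: ((Mmat Um + Mmat Up) *m (Evec Minus m.+1 - Evec Plus m))
  + (dy p * fcell (m.+1)%:Z * cell_hv (m.+1)%:Z) *: e2.

(* Q_{Psi,n+1/2} *)
Definition Qface (n : nat) : 'cV[R]_5 :=
  let Um := face_U Minus n in
  let Up := face_U Plus n in
  Fflux (grav p) Up - Fflux (grav p) Um
  - 2%:R^-1 *: ((Mmat Up + Mmat Um) *m (Evec Plus n - Evec Minus n)).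

Fixpoint Rminus (n : nat) : 'cV[R]_5 :=
  match n with
  | 0%N => 0
  | m.+1 => (Rminus m + Qface m) + Qcell m
  end.

Definition Rglob (s : side) (n : nat) : 'cV[R]_5 :=
  match s with
  | Minus => Rminus n
  | Plus => Rminus n + Qface n
  end.

Definition Kflux (s : side) (n : nat) : 'cV[R]_5 :=
  Fflux (grav p) (face_U s n) - Rglob s n.

Definition face_v (s : side) (n : nat) : R := face_hv s n / h s n.
Definition face_b (s : side) (n : nat) : R := face_hb s n / h s n.

Definition Hface (s : side) (n : nat) : 'cV[R]_6 :=
  col_mx (Kflux s n) ((face_v s n * face_B s n)%:M : 'cV[R]_1).

Definition wave (s : side) (n : nat) : R :=
  Num.sqrt (face_b s n ^+ 2 + grav p * h s n).

Definition splus (n : nat) : R :=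
  Num.max (Num.max (face_v Minus n + wave Minus n) (face_v Plus n + wave Plus n)) 0.

Definition sminus (n : nat) : R :=
  Num.min (Num.min (face_v Minus n - wave Minus n) (face_v Plus n - wave Plus n)) 0.

(* The numerical flux at interface n + 1/2 *)
Definition numflux (n : nat) : 'cV[R]_6 :=
  (splus n - sminus n)^-1 *: (splus n *: Hface Minus n - sminus n *: Hface Plus n)
  + (splus n * sminus n / (splus n - sminus n)) *:
      (face_What Plus n - face_What Minus n).

Definition scheme_rhs (k : nat) : 'cV[R]_6 :=
  - ((dy p)^-1 *: (numflux k - numflux k.-1)).

End Flux.
End Data.

(* The trajectory W satisfies the semi-discrete scheme at time t, where G, h, hh
   are the boundary data and interface heights at that time. *)
Definition scheme_at (W : R -> int -> 'cV[R]_6) (G : ghost_data R)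
    (h hh : side -> nat -> R) (t : R) : Prop :=
  forall k : nat, (1 <= k <= ncell p)%N ->
    is_derive t (1 : R) (fun s : R => W s k%:Z) (scheme_rhs (W t) G h hh k).

Definition u_steady (hv hb uc y : R) : R :=
  hv ^+ 2 / (hv ^+ 2 - hb ^+ 2) * (fc p * y + beta p / 2%:R * y ^+ 2) + uc.

Definition a_steady (hv hb ac y : R) : R :=
  hv * hb / (hv ^+ 2 - hb ^+ 2) * (fc p * y + beta p / 2%:R * y ^+ 2) + ac.

End Scheme.

(* Main.v *)
Require Import Defs.
From mathcomp Require Import zify ring lra.

(** On the steady states the equilibrium variables, unlike the conservative ones,
    are polynomials in y that the reconstructions reproduce exactly: hv, E, hb
    and B are constant, while u and a are affine if beta = 0 (where minmod is
    exact) and quadratic otherwise (where WENO-Z is exact, because each of the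
    three parabolas it averages is already the right one); see [uarec_quadratic].
    So at every interface the two traces of (hv, u, E, a, hb) agree, even though
    the heights may jump with the bottom.

    This agreement removes all numerical diffusion.  The interface source term
    [Qface] is then exactly the jump of the flux, so the global flux K has no jump
    ([Kflux_continuous]); the modified states coincide by the choice of the
    modified heights; and the central-upwind flux, a weighted mean of equal
    traces, reduces to the one-sided flux ([numflux_continuous]).

    Across one cell the flux differences cancel by construction, and the
    variation of K is M (E^- - E^+) - dy f hv e2 with the averaged matrix M
    ([Kflux_cell_step]).  Only the u and a components of E vary, and the
    corresponding columns of M contain nothing but hv and hb, which are constant
    ([Mmat_mul_ua]).  The variation therefore vanishes if
    hv du - hb da = dy f hv and hv da = hb du.  As dy f(y_k) is the integral of f
    over the cell (midpoint rule for an affine f), these are the increments of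
    the ordinary differential equations solved by [u_steady] and [a_steady]
    ([steady_increments]). *)

Local Open Scope ring_scope.

(** * Exactness of the reconstructions on polynomials *)

Lemma minmod_scaled (R : realType) (theta c : R) :
  1 <= theta -> minmod (theta * c) c (theta * c) = c.
Proof.
move=> theta1; rewrite /minmod.
have [c_gt0|c_lt0|<-] := ltrgtP 0 c.
- have tc : c <= theta * c by rewrite ler_peMl // ltW.
  have -> : 0 < theta * c by rewrite mulr_gt0 //; lra.
  by rewrite /= (min_l tc) min_r.
- have tc : theta * c <= c by rewrite ler_neMl // ltW.
  have tc_lt0 : theta * c < 0 by exact: le_lt_trans tc c_lt0.
  have -> : (0 < theta * c) = false by apply/negbTE; rewrite -leNgt ltW.
  by rewrite tc_lt0 /= (max_l tc) max_r.
- by rewrite mulr0 ltxx.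
Qed.

Lemma yface_Minus (R : realType) (p : setup R) (n : nat) :
  yface p n = ycell p n%:Z + dy p / 2%:R.
Proof. rewrite /yface /ycell -pmulrn; by field. Qed.

Lemma yface_Plus (R : realType) (p : setup R) (n : nat) :
  yface p n = ycell p (n.+1)%:Z - dy p / 2%:R.
Proof. rewrite /yface /ycell -pmulrn -natr1; by field. Qed.

Lemma ycellD (R : realType) (p : setup R) (k j : int) :
  ycell p (k + j) = ycell p k + j%:~R * dy p.
Proof. rewrite /ycell intrD; ring. Qed.

Lemma linrec_affine (R : realType) (p : setup R) (psi sl : int -> R) (c e : R)
    (s : side) (n : nat) :
  (forall k : int, n%:Z <= k <= (n.+1)%:Z ->
    psi k = c * ycell p k + e /\ sl k = c) ->
  linrec p psi sl s n = c * yface p n + e.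
Proof.
move=> aff; case: s => /=.
- have [|-> ->] := aff n%:Z; first by lia.
  rewrite yface_Minus; ring.
- have [|-> ->] := aff (n.+1)%:Z; first by lia.
  rewrite yface_Plus; ring.
Qed.

(** The centred slope is exact and, as theta >= 1, the two one-sided slopes are
    at least as steep, so that the limiter keeps the centred one. *)
Lemma mmslope_affine (R : realType) (p : setup R) (psi : int -> R) (c e : R)
    (k : int) :
  1 <= theta p -> 0 < dy p ->
  (forall j : int, k - 1 <= j <= k + 1 -> psi j = c * ycell p j + e) ->
  mmslope p psi k = c.
Proof.
move=> theta1 dy0 aff; rewrite /mmslope !aff; try lia.
rewrite !ycellD mulrNz mulr1z.
have dyN0 : dy p != 0 by rewrite gt_eqF.
rewrite -[RHS](@minmod_scaled _ (theta p)) //.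
by congr minmod; field; rewrite ?dyN0.
Qed.

Lemma mmrec_affine (R : realType) (p : setup R) (psi : int -> R) (c e : R)
    (s : side) (n : nat) :
  1 <= theta p -> 0 < dy p ->
  (forall k : int, n%:Z - 1 <= k <= n%:Z + 2 -> psi k = c * ycell p k + e) ->
  mmrec p psi s n = c * yface p n + e.
Proof.
move=> theta1 dy0 aff; apply: linrec_affine => k kn; split.
  by apply: aff; lia.
by apply: (@mmslope_affine _ _ _ _ e) => // j jk; apply: aff; lia.
Qed.

Definition quad {R : realType} (c2 c1 c0 y : R) : R := c2 * y ^+ 2 + c1 * y + c0.

Lemma interp2_quadratic (R : realType) (c2 c1 c0 x0 x1 x2 x : R) :
  x0 != x1 -> x0 != x2 -> x1 != x2 ->
  interp2 x0 x1 x2 (quad c2 c1 c0 x0) (quad c2 c1 c0 x1) (quad c2 c1 c0 x2) x =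
  quad c2 c1 c0 x.
Proof.
move=> x01 x02 x12; rewrite /interp2 /quad; field.
by rewrite !subr_eq0 ![x2 == _]eq_sym ![x1 == x0]eq_sym x01 x02 x12.
Qed.

Lemma ycell_mirror_neq (R : realType) (p : setup R) (d k i j : int) :
  0 < dy p -> d != 0 -> i != j ->
  ycell p (k + d * i) != ycell p (k + d * j).
Proof.
move=> dy0 d0 ij; have dyN0 : dy p != 0 by rewrite gt_eqF.
rewrite !ycellD (inj_eq (addrI _)) (inj_eq (mulIf dyN0)) eqr_int.
by rewrite (inj_eq (mulfI d0)).
Qed.

(** The three candidate parabolas all equal the data, so their mean does too,
    whatever the smoothness indicators; the weights have a positive sum because
    each of them is at least its linear weight. *)
Lemma wenoz_at_quadratic (R : realType) (p : setup R) (psi : int -> R)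
    (c2 c1 c0 : R) (d k : int) (x : R) :
  0 < dy p -> d != 0 ->
  (forall j : int, -2 <= j <= 2 ->
    psi (k + d * j) = quad c2 c1 c0 (ycell p (k + d * j))) ->
  wenoz_at p psi d k x = quad c2 c1 c0 x.
Proof.
move=> dy0 d0 psiE; rewrite /wenoz_at.
set b0 := _ + 1 / 4%:R * (_ - _ + 3%:R * _) ^+ 2.
set b1 := _ + 1 / 4%:R * (_ - _) ^+ 2.
set b2 := _ + 1 / 4%:R * (3%:R * _ - _ + _) ^+ 2.
set tau := `|b2 - b0|.
have alpha_gt0 (w b : R) :
    0 < w -> 0 < w * (1 + (tau / (b + weno_eps)) ^+ 2).
  by move=> w0; rewrite mulr_gt0 // ltr_wpDr // sqr_ge0.
set a0 := 1 / 16%:R * _; set a1 := 5%:R / 8%:R * _; set a2 := 5%:R / 16%:R * _.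
have a0_gt0 : 0 < a0 by apply: alpha_gt0; lra.
have a1_gt0 : 0 < a1 by apply: alpha_gt0; lra.
have a2_gt0 : 0 < a2 by apply: alpha_gt0; lra.
clearbody a0 a1 a2.
rewrite !psiE // !interp2_quadratic; try exact: ycell_mirror_neq.
by field; rewrite gt_eqF // !addr_gt0.
Qed.

Lemma wenorec_quadratic (R : realType) (p : setup R) (psi : int -> R)
    (c2 c1 c0 : R) (s : side) (n : nat) :
  0 < dy p ->
  (forall k : int, n%:Z - 2 <= k <= n%:Z + 3 ->
    psi k = quad c2 c1 c0 (ycell p k)) ->
  wenorec p psi s n = quad c2 c1 c0 (yface p n).
Proof.
by move=> dy0 psiE; case: s => /=; apply: wenoz_at_quadratic => // j j2;
  apply: psiE; lia.
Qed.

Lemma uarec_quadratic (R : realType) (p : setup R) (psi : int -> R)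
    (c2 c1 c0 : R) (s : side) (n : nat) :
  1 <= theta p -> 0 < dy p -> (n <= ncell p)%N ->
  (beta p = 0 -> c2 = 0) ->
  (forall k : int, in_grid p k -> psi k = quad c2 c1 c0 (ycell p k)) ->
  uarec p psi s n = quad c2 c1 c0 (yface p n).
Proof.
move=> theta1 dy0 nN c2E psiE; rewrite /uarec.
case: ifPn => [/eqP beta0|betaN0].
  rewrite /quad c2E // mul0r add0r; apply: mmrec_affine => // k kn.
  rewrite psiE; first by rewrite /quad c2E // mul0r add0r.
  rewrite /in_grid /nghost beta0 eqxx; lia.
apply: wenorec_quadratic => // k kn; apply: psiE.
by rewrite /in_grid /nghost (negbTE betaN0); lia.
Qed.

Lemma mmrec_const (R : realType) (p : setup R) (psi : int -> R) (e : R)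
    (s : side) (n : nat) :
  1 <= theta p -> 0 < dy p -> (n <= ncell p)%N ->
  (forall k : int, in_grid p k -> psi k = e) ->
  mmrec p psi s n = e.
Proof.
move=> theta1 dy0 nN psiE.
rewrite (@mmrec_affine _ _ _ 0 e) ?mul0r ?add0r // => k kn.
by rewrite mul0r add0r psiE // /in_grid /nghost; case: ifP => _; lia.
Qed.

(** * The global flux when the equilibrium traces agree *)

Lemma entry_colv (R : realType) (n : nat) (s : seq R) (i : nat) :
  (i < n.+1)%N -> entry (colv n.+1 s) i = s`_i.
Proof. by move=> i_lt; rewrite /entry mxE inordK. Qed.

Lemma Kflux_continuous (R : realType) (p : setup R) (W : int -> 'cV[R]_6)
    (G : ghost_data R) (h : side -> nat -> R) (n : nat) :
  Evec p W G Plus n = Evec p W G Minus n ->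
  Kflux p W G h Plus n = Kflux p W G h Minus n.
Proof.
move=> EE; rewrite /Kflux /= /Qface EE subrr mulmx0 scaler0 subr0.
by rewrite [_ + (_ - _)]addrC opprD opprB addrA subrKC.
Qed.

(** The terms F(U) in the cell source are there precisely to cancel the fluxes
    in K, which leaves the nonconservative product and the Coriolis force. *)
Lemma Kflux_cell_step (R : realType) (p : setup R) (W : int -> 'cV[R]_6)
    (G : ghost_data R) (h : side -> nat -> R) (m : nat) :
  Kflux p W G h Minus m.+1 = Kflux p W G h Plus m +
    (2%:R^-1 *: ((Mmat (face_U p W G h Minus m.+1) + Mmat (face_U p W G h Plus m))
                 *m (Evec p W G Minus m.+1 - Evec p W G Plus m))
     - (dy p * fcell p (m.+1)%:Z * cell_hv p W G (m.+1)%:Z) *: e2).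
Proof.
rewrite /Kflux /= /Qcell.
move: (Fflux _ _) (Fflux _ _) (Rminus _ _ _ _ _ + _) (_ *: _) (_ *: _).
move=> FM FP S X Y; apply/colP => i; rewrite !mxE; ring.
Qed.

Lemma Mmat_mul_ua (R : realType) (U : 'cV[R]_5) (du da : R) :
  Mmat U *m colv 5 [:: 0; du; 0; da; 0] =
  colv 5 [:: 0; entry U 2 * du - entry U 4 * da; 0;
             entry U 2 * da - entry U 4 * du; 0].
Proof.
apply/colP => i; rewrite !mxE !big_ord_recl big_ord0 !mxE /=.
by case: i => [[|[|[|[|[|]]]]] ?] //=; ring.
Qed.

(** The wave speeds enclose the interval between v - c and v + c, c > 0, which
    makes the denominator of the numerical flux positive. *)
Lemma sminus_lt_splus (R : realType) (p : setup R) (W : int -> 'cV[R]_6)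
    (G : ghost_data R) (h : side -> nat -> R) (n : nat) :
  0 < grav p -> 0 < h Minus n -> sminus p W G h n < splus p W G h n.
Proof.
move=> g0 h0.
have wave_gt0 : 0 < wave p W G h Minus n.
  by rewrite sqrtr_gt0 ltr_wpDl ?sqr_ge0 ?mulr_gt0.
apply: (@le_lt_trans _ _ (face_v p W G h Minus n - wave p W G h Minus n)).
  by rewrite /sminus !ge_min lexx.
apply: (@lt_le_trans _ _ (face_v p W G h Minus n + wave p W G h Minus n)).
  by lra.
by rewrite /splus !le_max lexx.
Qed.

Lemma numflux_continuous (R : realType) (p : setup R) (W : int -> 'cV[R]_6)
    (G : ghost_data R) (h hh : side -> nat -> R) (n : nat) :
  sminus p W G h n < splus p W G h n ->
  Hface p W G h Plus n = Hface p W G h Minus n ->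
  face_What p W G hh Plus n = face_What p W G hh Minus n ->
  numflux p W G h hh n = Hface p W G h Minus n.
Proof.
move=> ss HE WE; rewrite /numflux HE WE subrr scaler0 addr0 -scalerBl scalerA.
by rewrite mulVf ?scale1r // subr_eq0 gt_eqF.
Qed.

(** * The steady states *)

Lemma u_steadyE (R : realType) (p : setup R) (hv hb uc y : R) :
  u_steady p hv hb uc y =
  quad (hv ^+ 2 / (hv ^+ 2 - hb ^+ 2) * (beta p / 2%:R))
       (hv ^+ 2 / (hv ^+ 2 - hb ^+ 2) * fc p) uc y.
Proof. by rewrite /u_steady /quad; ring. Qed.

Lemma a_steadyE (R : realType) (p : setup R) (hv hb ac y : R) :
  a_steady p hv hb ac y =
  quad (hv * hb / (hv ^+ 2 - hb ^+ 2) * (beta p / 2%:R))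
       (hv * hb / (hv ^+ 2 - hb ^+ 2) * fc p) ac y.
Proof. by rewrite /a_steady /quad; ring. Qed.

(** These integrate (hv) u' - (hb) a' = f (hv) and (hv) a' = (hb) u' over a cell;
    the midpoint rule is exact as f is affine. *)
Lemma steady_increments (R : realType) (p : setup R) (hv hb uc ac : R) (m : nat) :
  hv ^+ 2 <> hb ^+ 2 ->
  let du := u_steady p hv hb uc (yface p m.+1) - u_steady p hv hb uc (yface p m) in
  let da := a_steady p hv hb ac (yface p m.+1) - a_steady p hv hb ac (yface p m) in
  hv * du - hb * da = dy p * fcell p (m.+1)%:Z * hv /\ hv * da - hb * du = 0.
Proof.
move=> /eqP hvb du da; rewrite -subr_eq0 in hvb.
rewrite /du /da (yface_Minus _ _ m.+1) (yface_Plus _ _ m).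
rewrite /u_steady /a_steady /fcell /fcor.
by split; field.
Qed.

Theorem theorem2p2 (R : realType) (p : setup R)
    (W : R -> int -> 'cV[R]_6) (G : ghost_data R)
    (h hh : side -> nat -> R) (t : R)
    (hv_eq E_eq hb_eq uc ac : R)
    (grav_gt0 : 0 < grav p)
    (theta_range : 1 <= theta p <= 2%:R)
    (dy_gt0 : 0 < dy p)
    (cell_h_gt0 : forall k : int, in_grid p k -> 0 < cell_h p (W t) G k)
    (face_height : forall n : nat, (n <= ncell p)%N -> is_face_height p (W t) G h n)
    (face_h_gt0 : forall (s : side) (n : nat), (n <= ncell p)%N -> 0 < h s n)
    (mod_height : forall n : nat, (n <= ncell p)%N -> is_mod_height p (W t) G hh n)
    (hv_neq_hb : hv_eq ^+ 2 <> hb_eq ^+ 2)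
    (steady : forall k : int, in_grid p k ->
      cell_hv p (W t) G k = hv_eq /\
      cell_E p (W t) G k = E_eq /\
      cell_hb p (W t) G k = hb_eq /\
      cell_B p (W t) G k = 0 /\
      cell_u p (W t) G k = u_steady p hv_eq hb_eq uc (ycell p k) /\
      cell_a p (W t) G k = a_steady p hv_eq hb_eq ac (ycell p k)) :
  (forall k : nat, (1 <= k <= ncell p)%N ->
    numflux p (W t) G h hh k = numflux p (W t) G h hh k.-1) /\
  (scheme_at p W G h hh t ->
   forall k : nat, (1 <= k <= ncell p)%N ->
    is_derive t (1 : R) (fun s : R => W s k%:Z) 0).
Proof.
have /andP[theta1 _] := theta_range.
have face_hvE s n : (n <= ncell p)%N -> face_hv p (W t) G s n = hv_eq.
  by move=> nN; apply: mmrec_const => // k /steady[].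
have face_EE s n : (n <= ncell p)%N -> face_E p (W t) G s n = E_eq.
  by move=> nN; apply: mmrec_const => // k /steady[_ []].
have face_BE s n : (n <= ncell p)%N -> face_B p (W t) G s n = 0.
  by move=> nN; apply: mmrec_const => // k /steady[_ [_ [_ []]]].
have face_hbE s n : (n <= ncell p)%N -> face_hb p (W t) G s n = hb_eq.
  move=> nN; rewrite /face_hb (@linrec_affine _ _ _ _ 0 hb_eq) => [|k kn].
    by rewrite mul0r add0r.
  have [|_ [_ [-> [-> _]]]] := steady k; last by rewrite mul0r add0r.
  by rewrite /in_grid /nghost; case: ifP => _; lia.
have face_uE s n : (n <= ncell p)%N ->
    face_u p (W t) G s n = u_steady p hv_eq hb_eq uc (yface p n).
  move=> nN; rewrite u_steadyE; apply: uarec_quadratic => // [->|k].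
    by rewrite mul0r mulr0.
  by move=> /steady[_ [_ [_ [_ [-> _]]]]]; rewrite u_steadyE.
have face_aE s n : (n <= ncell p)%N ->
    face_a p (W t) G s n = a_steady p hv_eq hb_eq ac (yface p n).
  move=> nN; rewrite a_steadyE; apply: uarec_quadratic => // [->|k].
    by rewrite mul0r mulr0.
  by move=> /steady[_ [_ [_ [_ [_ ->]]]]]; rewrite a_steadyE.
have KE n : (n <= ncell p)%N ->
    Kflux p (W t) G h Plus n = Kflux p (W t) G h Minus n.
  move=> nN; apply: Kflux_continuous.
  by rewrite /Evec !face_hvE // !face_uE // !face_EE // !face_aE // !face_hbE.
have numfluxE n : (n <= ncell p)%N ->
    numflux p (W t) G h hh n = Hface p (W t) G h Minus n.
  move=> nN; apply: numflux_continuous.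
  - by apply: sminus_lt_splus => //; apply: face_h_gt0.
  - by rewrite /Hface KE // !face_BE // !mulr0.
  - have [_ [|hhE _]] := mod_height n nN.
      by split; rewrite ?face_hvE // ?face_hbE // ?face_EE.
    rewrite /face_What hhE !face_hvE // !face_uE // !face_aE // !face_hbE //.
    by rewrite !face_BE.
have balanced k : (1 <= k <= ncell p)%N ->
    numflux p (W t) G h hh k = numflux p (W t) G h hh k.-1.
  case: k => // m /andP[_ mN] /=; have mN' := ltnW mN.
  rewrite !numfluxE // /Hface !face_BE // !mulr0 -(KE m) // Kflux_cell_step.
  have [] := steady_increments _ p _ _ uc ac m hv_neq_hb.
  set du := u_steady _ _ _ _ _ - _; set da := a_steady _ _ _ _ _ - _.
  move=> duE daE.
  have -> : Evec p (W t) G Minus m.+1 - Evec p (W t) G Plus m =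
            colv 5 [:: 0; du; 0; da; 0].
    rewrite /Evec !face_hvE // !face_uE // !face_EE // !face_aE // !face_hbE //.
    apply/colP => i; rewrite !mxE.
    by case: i => [[|[|[|[|[|]]]]] ?] //=; rewrite subrr.
  have ->: cell_hv p (W t) G m.+1 = hv_eq.
    have [] // := steady m.+1%:Z.
    by rewrite /in_grid /nghost; case: ifP => _; lia.
  have MUE U : entry U 2 = hv_eq -> entry U 4 = hb_eq ->
      Mmat U *m colv 5 [:: 0; du; 0; da; 0] =
      (dy p * fcell p m.+1 * hv_eq) *: e2.
    move=> U2 U4; rewrite Mmat_mul_ua U2 U4 duE daE.
    apply/colP => i; rewrite !mxE.
    by case: i => [[|[|[|[|[|]]]]] ?] //=; rewrite ?mulr0 ?mulr1.
  have entry_U s n : (n <= ncell p)%N ->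
      entry (face_U p (W t) G h s n) 2 = hv_eq /\
      entry (face_U p (W t) G h s n) 4 = hb_eq.
    by move=> nN; rewrite !entry_colv // -[in RHS](face_hvE s n) // -(face_hbE s n).
  have [U12 U14] := entry_U Minus _ mN; have [U02 U04] := entry_U Plus _ mN'.
  rewrite mulmxDl !MUE // -scalerDl scalerA -scalerBl.
  by rewrite (_ : _ - _ = 0) ?scale0r ?addr0 //; field.
split=> // scheme k kN; move: (scheme k kN).
by rewrite /scheme_rhs balanced // subrr scaler0 oppr0.
Qed.
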